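(* Let $0<\alpha<1$, $T>0$, $\Omega_T=\mathbb{R}\times(0,T)$. Let $q\in C(\mathbb{R})$ with $q(x)\ge 0$ for all $x\in\mathbb{R}$, and assume $$\int_{-\infty}^0\left|\frac{1}{q(\xi)}\right|d\xi=\infty.$$ Let $F\in C(\mathbb{R}\times[0,T])$ and $a\in W^{1,1}_{loc}(\mathbb{R})$ be real-valued. Let $u\in C(\mathbb{R}\times[0,T])\cap L^\infty(\mathbb{R}\times(0,T))$ be a real-valued function with $u(x,\cdot)\in W^{1,1}(0,T)$ and $u(\cdot,t)\in W^{1,1}_{loc}(\mathbb{R})$, satisfying $$\partial_t^{\alpha}u(x,t)+q(x)\,\partial_xu(x,t)=F(x,t),\quad (x,t)\in\Omega_T,\qquad u(x,0)=a(x),\quad x\in\mathbb{R}.$$ If $F(x,t)\le 0$ for all $(x,t)\in\Omega_T$, then $$\sup_{(x,t)\in\Omega_T}u(x,t)=\sup_{x\in\mathbb{R}}a(x).$$ If $F(x,t)\ge 0$ for all $(x,t)\in\Omega_T$, then $$\inf_{(x,t)\in\Omega_T}u(x,t)=\inf_{x\in\mathbb{R}}a(x).$$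
   Context: For $0<\alpha<1$ the Caputo derivative in time is $\partial_t^{\alpha}u(x,t)=\frac{1}{\Gamma(1-\alpha)}\int_0^t(t-s)^{-\alpha}\frac{\partial}{\partial s}u(x,s)\,ds$, where $\Gamma$ is the Euler gamma function, and $\partial_x$ is the ordinary first-order partial derivative in $x$. For an interval $I$, $W^{1,1}(I)$ is the space of functions in $L^1(I)$ with derivative in $L^1(I)$; $a\in W^{1,1}_{loc}(\mathbb{R})$ means $a|_{(-X,X)}\in W^{1,1}(-X,X)$ for every $X>0$.
   Formalization: The assumption that the integral of |1/q| over (-∞,0] is infinite is required over (-∞,X] for every X≤0 (with 1/0=∞): otherwise a non-integrable zero of q can make it hold while the claim fails. The two agree if 1/q is locally integrable on (-∞,0]. *)

(* Defs.v *)
From HB Require Import structures.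
From mathcomp Require Import all_boot all_order all_algebra.
From mathcomp Require Import all_classical all_reals all_analysis.

Set Implicit Arguments.
Unset Strict Implicit.
Unset Printing Implicit Defensive.
Import Order.TTheory GRing.Theory Num.Theory.
Import numFieldNormedType.Exports.

Local Open Scope classical_set_scope.
Local Open Scope ring_scope.

Definition euler_gamma (R : realType) (z : R) : R :=
  \int[@lebesgue_measure R]_(t in `]0, +oo[) (t `^ (z - 1) * expR (- t)).

(* As is usual in dimension one (e.g. Brezis), test functions are C^1 with
   compact support in I; this defines the same weak derivative as C_c^oo. *)
Definition test_function (R : realType) (I : set R) (phi : R -> R) : Prop :=
  [/\ forall x, derivable phi x 1,
      continuous (derive1 phi) &
      exists K : set R, [/\ compact K, K `<=` I & forall x, ~ K x -> phi x = 0]].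

Definition is_weak_derivative (R : realType) (I : set R) (f g : R -> R) : Prop :=
  forall phi, test_function I phi ->
    \int[@lebesgue_measure R]_(x in I) (f x * derive1 phi x) =
    - \int[@lebesgue_measure R]_(x in I) (g x * phi x).

Definition W11 (R : realType) (I : set R) (f : R -> R) : Prop :=
  (@lebesgue_measure R).-integrable I (EFin \o f) /\
  exists g : R -> R,
    (@lebesgue_measure R).-integrable I (EFin \o g) /\ is_weak_derivative I f g.

Definition W11loc (R : realType) (f : R -> R) : Prop :=
  forall X : R, 0 < X -> W11 `](- X), X[ f.

Definition Linfty (R : realType) (D : set (R * R)) (u : R * R -> R) : Prop :=
  measurable_fun D u /\
  exists M : R,
    {ae (@lebesgue_measure R \x @lebesgue_measure R)%E,
      forall z, D z -> `|u z| <= M}.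

(* A continuous function of class W^{1,1} is differentiable almost everywhere,
   with pointwise derivative equal to its weak derivative, so that derive1 f below
   may be read in either sense. *)
Definition caputo_integrand (R : realType) (alpha : R) (f : R -> R) (t s : R) : R :=
  (t - s) `^ (- alpha) * derive1 f s.

Definition caputo (R : realType) (alpha : R) (f : R -> R) (t : R) : R :=
  (euler_gamma (1 - alpha))^-1 *
  \int[@lebesgue_measure R]_(s in `]0, t[) caputo_integrand alpha f t s.

Definition caputo_defined (R : realType) (alpha : R) (f : R -> R) (t : R) : Prop :=
  (@lebesgue_measure R).-integrable `]0, t[ (EFin \o caputo_integrand alpha f t).

(* Points of the plane are pairs (x, t). *)
Definition Omega (R : realType) (T : R) : set (R * R) := [set z | 0 < z.2 < T].

Definition Omega_closed (R : realType) (T : R) : set (R * R) :=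
  [set z | 0 <= z.2 <= T].

(* Derivatives and Lebesgue integrals being total functions, the first two
   clauses say that both terms on the left of the equation are meaningful. *)
Definition transport_eq_at (R : realType) (alpha : R) (q : R -> R)
    (F u : R * R -> R) (x t : R) : Prop :=
  [/\ caputo_defined alpha (fun s => u (x, s)) t,
      derivable (fun y => u (y, t)) x 1 &
      caputo alpha (fun s => u (x, s)) t + q x * derive1 (fun y => u (y, t)) x
      = F (x, t)].

(* int_{-oo}^0 |1/q| = +oo, as an integral that is improper at -oo: every tail
   diverges.  The inverse is taken in \bar R, so 1/0 = +oo.  If 1/q is locally
   integrable on ]-oo, 0], then the case X = 0 alone is equivalent.  In general
   it is not: a zero of q at which 1/q is not integrable, as for
   q x = |x + 1| near -1, makes that case hold even if q grows so fast at -oo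
   that characteristics enter from -oo in finite time, and then the maximum
   principle fails. *)
Definition inv_diverges_at_ninfty (R : realType) (q : R -> R) : Prop :=
  forall X : R, X <= 0 ->
    (\int[@lebesgue_measure R]_(x in `]-oo, X]) `| ((q x)%:E)^-1 | = +oo)%E.

(* Main.v *)
(* Write Gamma for euler_gamma (1 - alpha).  If f is absolutely continuous and
   f <= f t on [0, t], then writing the kernel (t - s)^(-alpha) as its value at 0
   plus a superposition of indicators of intervals ]r, t[, over which f' has
   integral f t - f r >= 0, gives
     caputo f t >= t^(-alpha) (f t - f 0) / Gamma.
   Suppose F <= 0 and u (x0, t0) > sup a.  Let phi x be the integral of 1/q over
   [x, x0], so that q phi' = -1 and phi tends to +oo at -oo (or stop at a zero of
   q, through which no information flows to the right).  Since u is bounded, for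
   every small d > 0 the function u - d phi has a maximum on ]-oo, x0] x [0, t0],
   at a point with t > 0.  There the Caputo term is bounded below by a positive
   constant independent of d, while q u_x >= - d, which contradicts the equation
   for d small.  The infimum is handled by replacing u with - u. *)

Require Import Defs.
From HB Require Import structures.
From mathcomp Require Import all_boot all_order all_algebra.
From mathcomp Require Import all_classical all_reals all_analysis.
From mathcomp Require Import measurable_realfun ring lra.

Import Order.TTheory GRing.Theory Num.Theory.
Import numFieldNormedType.Exports.

Local Open Scope classical_set_scope.
Local Open Scope ring_scope.

Section maximum_principle.
Local Set Implicit Arguments.
Local Unset Strict Implicit.
Context {R : realType}.
Implicit Types (f g : R -> R) (a b r s t x : R).
Notation mu := (@lebesgue_measure R).

(** * Integration *)

(** Splitting the union into the disjoint differences [seqDU A] turns the integral into a series,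
    each partial sum of which is an integral over a subset of some [A n]. This carries bounds on
    compact intervals over to half-lines. *)
Lemma ge0_integral_bigcup_le (A : nat -> set (measurableTypeR R)) (f : R -> \bar R) (K : \bar R) :
  (forall n, measurable (A n)) -> nondecreasing_seq A ->
  measurable_fun (\bigcup_n A n) f ->
  (forall x, (\bigcup_n A n) x -> 0 <= f x)%E ->
  (forall n, \int[mu]_(x in A n) f x <= K)%E ->
  (\int[mu]_(x in \bigcup_n A n) f x <= K)%E.
Proof.
move=> mA ndA mf f0 fK.
have mU : measurable (\bigcup_n A n) by exact: bigcupT_measurable.
have mD n : measurable (seqDU A n).
  by apply: measurableD => //; exact: bigsetU_measurable.
have sA n : A n `<=` \bigcup_n A n by exact: bigcup_sup.
move: (mf) (f0); rewrite seqDU_bigcup_eq => mf' f0'.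
rewrite ge0_integral_bigcup//.
apply: lime_le.
  apply: is_cvg_nneseries => n _ _.
  apply: integral_ge0 => x [Ax _]; exact/f0/(sA n).
apply: nearW => n.
have sDA : \big[setU/set0]_(i < n) seqDU A i `<=` A n.
  rewrite -bigsetU_seqDU -(bigcup_mkord n A) => x [k /= kn Akx].
  by have /subsetPset := ndA _ _ (ltnW kn); apply.
rewrite -(big_mkord xpredT) in sDA.
rewrite -ge0_integral_bigsetU//=; last 4 first.
- exact: iota_uniq.
- exact: (sub_trivIset (@subsetT _ _)).
- exact: (measurable_funS mU (subset_trans sDA (sA n)) mf).
- by move=> x Ax; exact/f0/(sA n x)/sDA.
apply: le_trans (fK n); apply: ge0_subset_integral => //.
- by apply: bigsetU_measurable => i _; exact: mD.
- exact: (measurable_funS mU (sA n) mf).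
- by move=> x Ax; exact/f0/(sA n x).
Qed.

Lemma Rdominated_cvg (D : set (measurableTypeR R)) (f_ : nat -> R -> R) (f g : R -> R) :
  measurable D ->
  (forall n, measurable_fun D (f_ n)) ->
  measurable_fun D f ->
  (forall x, D x -> f_ n x @[n --> \oo] --> f x) ->
  mu.-integrable D (EFin \o g) ->
  (forall n x, D x -> `|f_ n x| <= g x) ->
  \int[mu]_(x in D) f_ n x @[n --> \oo] --> \int[mu]_(x in D) f x.
Proof.
move=> mD mf_ mf cf intg fg.
have [|||||intf _ cvI] := @dominated_convergence _ _ R mu D mD
  (fun n => EFin \o f_ n) (EFin \o f) (EFin \o g).
- by move=> n; apply/measurable_EFinP; exact: mf_.
- by apply/measurable_EFinP; exact: mf.
- by apply: aeW => x Dx; apply: cvg_EFin; [exact: nearW|exact: cf].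
- exact: intg.
- by apply: aeW => x n Dx /=; rewrite lee_fin fg.
move: cvI; rewrite -(@fineK _ (\int[mu]_(x in D) (EFin \o f) x)%E); last first.
  exact: integrable_fin_num.
by move/fine_cvg.
Qed.

Lemma Rintegral_sum (I : Type) (l : seq I) (D : set (measurableTypeR R)) (f_ : I -> R -> R) :
  measurable D -> (forall i, mu.-integrable D (EFin \o f_ i)) ->
  \int[mu]_(x in D) (\sum_(i <- l) f_ i x) =
  \sum_(i <- l) \int[mu]_(x in D) f_ i x.
Proof.
move=> mD intf.
have H : mu.-integrable D (fun x => (\sum_(i <- l) f_ i x)%:E) /\
   \int[mu]_(x in D) (\sum_(i <- l) f_ i x) =
  \sum_(i <- l) \int[mu]_(x in D) f_ i x; last exact: H.2.
elim: l => [|i l [intl IH]].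
  rewrite big_nil; under eq_fun do rewrite big_nil; split => //.
  - exact: integrable0.
  - by under eq_Rintegral do rewrite big_nil; rewrite Rintegral_cst// mul0r.
split.
  under eq_fun do rewrite big_cons EFinD.
  exact: (integrableD mD (intf i) intl).
rewrite big_cons -IH -(RintegralD mD (intf i) intl).
by under eq_Rintegral do rewrite big_cons.
Qed.

Lemma integrable_scale (k : R) (D : set (measurableTypeR R)) (f : R -> R) :
  measurable D -> mu.-integrable D (EFin \o f) ->
  mu.-integrable D (EFin \o (fun x => k * f x)).
Proof. by move=> mD intf; exact: (@integrableZl _ _ _ mu D mD k (EFin \o f) intf). Qed.

(** * Integrals against a monotone kernel *)

(** The sum counts the integers from 1 to [m] that are at most [z]: it is the smaller of [m] and the
    floor of [z]. *)
Lemma sum_indicator_floor (m : nat) (z : R) : 0 <= z ->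
  let c := \sum_(j < m) (j.+1%:R <= z)%R%:R in
  c <= z /\ (z < m%:R -> z - 1 <= c).
Proof.
move=> z0 c.
(* The induction needs the exact value [m] of a saturated sum, both to add one more indicator and to
   treat [z] between [m] and [m + 1]. *)
suff [H1 H2] : (m%:R <= z -> c = m%:R) /\ (z < m%:R -> z - 1 <= c <= z).
  split => [|/H2/andP[]//].
  by have [zm|mz] := ltP z m%:R; [case/andP: (H2 zm)|rewrite (H1 mz)].
rewrite /c; elim: m {c} => [|m [IH1 IH2]].
  by rewrite big_ord0; split => // z0'; lra.
rewrite big_ord_recr /=.
have E : m.+1%:R = m%:R + 1 :> R by rewrite natr1.
rewrite !E; have [mz|zm] := leP (m%:R + 1) z; split.
- by move=> _; rewrite IH1 ?mulr1n//; lra.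
- by lra.
- by lra.
move=> _; rewrite addr0.
have [zm'|mz'] := ltP z m%:R; first exact: IH2.
by rewrite (IH1 mz'); lra.
Qed.

(** A nonempty upper subset of ]0, t[ is an interval from its infimum [r] to [t]. Whether it
    contains [r] does not affect the integral, which is [f t - f r]. *)
Lemma upper_set_Rintegral_ge0 (t : R) (D f : R -> R) (S : set (measurableTypeR R)) :
  mu.-integrable `]0, t[ (EFin \o D) ->
  (forall r, 0 <= r < t -> \int[mu]_(s in `]r, t[) D s = f t - f r) ->
  (forall r, 0 <= r < t -> f r <= f t) ->
  S `<=` `]0, t[ -> (forall x y, S x -> x <= y -> y < t -> S y) ->
  0 <= \int[mu]_(s in S) D s.
Proof.
move=> iD DE fle St Sup.
have [->|/set0P[x0 Sx0]] := eqVneq S set0; first by rewrite Rintegral_set0.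
have lbS : has_lbound S by exists 0 => x /St /=; rewrite in_itv/= => /andP[/ltW].
have hS : has_inf S by split => //; exists x0.
pose r := inf S.
have r0 : 0 <= r.
  by apply: lb_le_inf; [exists x0|move=> x /St /=; rewrite in_itv/= => /andP[/ltW]].
have rt : r < t.
  have := St _ Sx0; rewrite /= in_itv/= => /andP[_]; apply: le_lt_trans.
  exact: ge_inf.
have rS x : r < x -> x < t -> S x.
  move=> rx xt; have [y Sy yx] := inf_lt (hS.1) rx.
  exact: (Sup y x Sy (ltW yx)).
have iDr : mu.-integrable `]r, t[ (EFin \o D).
  by apply: integrableS iD => //; apply: subset_itvr; rewrite bnd_simp.
have Ir : 0 <= \int[mu]_(s in `]r, t[) D s.
  by rewrite DE ?r0// subr_ge0 fle// r0.
have [Sr|nSr] := pselect (S r).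
  rewrite (_ : S = `[r, t[%classic); first by rewrite -Rintegral_itv_obnd_cbnd.
  apply/seteqP; split => x /=; rewrite in_itv/=.
    move=> Sx; have := St _ Sx; rewrite /= in_itv/= => /andP[_ ->].
    by rewrite andbT; exact: ge_inf.
  by move=> /andP[]; rewrite le_eqVlt => /predU1P[<-//|]; exact: rS.
rewrite (_ : S = `]r, t[%classic)//.
apply/seteqP; split => x /=; rewrite in_itv/=; last by move=> /andP[]; exact: rS.
move=> Sx; have := St _ Sx; rewrite /= in_itv/= => /andP[_ ->].
rewrite andbT lt_neqAle; apply/andP; split; last exact: ge_inf.
by apply: contra_notN nSr => /eqP ->.
Qed.

(* Layer cake: [k - k0] is a limit of nonnegative combinations of indicators of
   upper subsets of ]0, t[, over each of which [D] has nonnegative integral. *)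
Lemma monotone_kernel_Rintegral_ge (t k0 : R) (k D f : R -> R) :
  0 < t ->
  mu.-integrable `]0, t[ (EFin \o D) ->
  mu.-integrable `]0, t[ (EFin \o (fun s => k s * D s)) ->
  measurable_fun (`]0, t[ : set (measurableTypeR R)) k ->
  (forall s, 0 < s < t -> k0 <= k s) ->
  (forall r s, 0 < r -> r <= s -> s < t -> k r <= k s) ->
  (forall r, 0 <= r < t -> \int[mu]_(s in `]r, t[) D s = f t - f r) ->
  (forall r, 0 <= r < t -> f r <= f t) ->
  k0 * (f t - f 0) <= \int[mu]_(s in `]0, t[) (k s * D s).
Proof.
move=> t0 iD ikD mk k0k kmono DE fle.
set I : set (measurableTypeR R) := `]0, t[%classic.
have mI : measurable I by exact: measurable_itv.
(* The constant [k0] alone contributes exactly the claimed bound, so it remains to see that the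
   kernel [y >= 0] contributes a nonnegative amount. *)
pose y s := k s - k0.
have y0 s : I s -> 0 <= y s by rewrite /I/= in_itv/= subr_ge0; exact: k0k.
have my : measurable_fun I y by exact: measurable_funB.
have iyD : mu.-integrable I (EFin \o (fun s => y s * D s)).
  rewrite (_ : EFin \o _ =
    ((EFin \o (fun s => (k s * D s)%R)) \- (fun s => k0%:E * (EFin \o D) s))%E).
    by apply: integrableB => //; exact: integrable_scale.
  by apply/funext => s /=; rewrite /y mulrBl EFinB EFinM.
have yE : \int[mu]_(s in I) (k s * D s) =
    \int[mu]_(s in I) (y s * D s) + k0 * (f t - f 0).
  rewrite -(DE 0) ?lexx// -RintegralZl// -RintegralD//.
    by apply: eq_Rintegral => s _; rewrite /y; ring.
  exact: integrable_scale.
rewrite yE lerDr.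
pose S n j : set (measurableTypeR R) := I `&` [set s | j.+1%:R / n.+1%:R <= y s].
have mS n j : measurable (S n j).
  rewrite /S -[X in _ `&` X]/(y @^-1` [set z | j.+1%:R / n.+1%:R <= z]).
  have := my mI (`[j.+1%:R / n.+1%:R, +oo[)%classic.
  rewrite (_ : `[_, +oo[%classic = [set z | j.+1%:R / n.+1%:R <= z]); last first.
    by apply/seteqP; split => z /=; rewrite in_itv/= andbT.
  apply; rewrite (_ : [set z | _] = (`[j.+1%:R / n.+1%:R, +oo[)%classic).
    exact: measurable_itv.
  by apply/seteqP; split => z /=; rewrite in_itv/= andbT.
(* The levels are spaced by [1 / (n + 1)] and reach height [n + 1]: the squared number of levels
   refines the mesh and at the same time exhausts a kernel that may be unbounded near [t]. *)
pose g n s := \sum_(j < n.+1 ^ 2) (n.+1%:R^-1 * (\1_(S n j) s * D s)).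
have iSD n j : mu.-integrable I (EFin \o (fun s => \1_(S n j) s * D s)).
  apply: le_integrable (iD) => //.
    apply/measurable_EFinP; apply: measurable_funM => //.
    by have /integrableP[/measurable_EFinP] := iD.
  move=> s _ /=; rewrite lee_fin normrM ler_piMl// indicE.
  by case: (_ \in _); rewrite ?normr0 ?normr1.
have gE n s : I s -> g n s =
    n.+1%:R^-1 * (\sum_(j < n.+1 ^ 2) (j.+1%:R <= n.+1%:R * y s)%R%:R) * D s.
  move=> Is; rewrite /g mulr_sumr mulr_suml; apply: eq_bigr => j _.
  rewrite mulrA; congr (_ * _ * _); rewrite indicE; congr ((nat_of_bool _)%:R).
  apply/idP/idP => [/set_mem[_ /=]|h]; first by rewrite ler_pdivrMr// mulrC.
  by apply/mem_set; split => //=; rewrite ler_pdivrMr// mulrC.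
have Ny0 n s : I s -> 0 <= n.+1%:R * y s by move=> Is; rewrite mulr_ge0// y0.
have cvI : \int[mu]_(s in I) g n s @[n --> \oo] --> \int[mu]_(s in I) (y s * D s).
  (* The step approximation of [y] lies between 0 and [y], whence the dominating function; once
     [y s < n + 1], its error is at most [1 / (n + 1)]. *)
  apply: (@Rdominated_cvg I g (fun s => y s * D s) (fun s => `|y s * D s|)) => //.
  - move=> n; apply: measurable_sum => j; apply: measurable_funM => //.
    by have /integrableP[/measurable_EFinP] := iSD n j.
  - by have /integrableP[/measurable_EFinP] := iyD.
  - move=> s Is; under eq_fun do rewrite (gE _ _ Is).
    apply: cvgMr_tmp.
    apply/cvgrPdist_le => e e0; near=> n.
    have [H1] := sum_indicator_floor (n.+1 ^ 2) (Ny0 n s Is).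
    rewrite natrX => H2.
    have n0 : 0 < n.+1%:R :> R by [].
    have yn : y s < n.+1%:R.
      by apply: (@lt_le_trans _ _ n%:R); [near: n; exact: nbhs_infty_gtr|rewrite ler_nat].
    have H3 : n.+1%:R * y s < n.+1%:R ^+ 2 by rewrite expr2 ltr_pM2l.
    move: (H2 H3) H1; set c := \sum_(_ < _) _ => H4 H1.
    have en : n.+1%:R^-1 <= e.
      by apply/ltW; near: n; exact: (near_infty_natSinv_lt (PosNum e0)).
    rewrite ger0_norm; last by rewrite subr_ge0 mulrC ler_pdivrMr// mulrC.
    apply: le_trans en; rewrite -[X in X - _](@mulKf _ n.+1%:R)// -mulrBr.
    by rewrite ler_piMr ?invr_ge0//; lra.
  - by have := integrable_norm iyD.
  - move=> n s Is; rewrite gE// normrM [leRHS]normrM ler_wpM2r//.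
    have [H1 _] := sum_indicator_floor (n.+1 ^ 2) (Ny0 n s Is).
    rewrite ger0_norm ?mulr_ge0 ?sumr_ge0// ger0_norm ?y0//.
    by rewrite mulrC ler_pdivrMr// [leRHS]mulrC.
rewrite -(cvg_lim _ cvI)//; apply: limr_ge; first by apply/cvg_ex; eexists; exact: cvI.
apply: nearW => n; rewrite /g Rintegral_sum//; last by move=> j; exact: integrable_scale.
apply: sumr_ge0 => j _; rewrite RintegralZl//; apply: mulr_ge0 => //.
rewrite (_ : \int[mu]_(s in I) _ = \int[mu]_(s in S n j) D s); last first.
  rewrite /S Rintegral_mkcondr; apply: eq_Rintegral => s /set_mem Is.
  rewrite patchE indicE in_setI (mem_set Is) /=.
  by case: ifPn => _; rewrite ?mul1r ?mul0r.
apply: (@upper_set_Rintegral_ge0 t D f) => //.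
  by move=> s [].
move=> r s [Ir yr] rs st; split => /=.
  move: Ir; rewrite /I/= !in_itv/= st => /andP[r0 _].
  by rewrite (lt_le_trans r0).
apply: (le_trans yr); rewrite /y lerD2r kmono//.
by move: Ir; rewrite /I/= in_itv/= => /andP[].
Unshelve. all: by end_near.
Qed.

(** * Positivity of the gamma function *)

Lemma continuous_powR (p t : R) : 0 < t -> {for t, continuous (fun t : R => t `^ p)}.
Proof.
move=> t0; have [H _] := is_derive1_powR p t0.
exact/differentiable_continuous/derivable1_diffP.
Qed.

Lemma ler_powR_npos (p s t : R) : p <= 0 -> 0 < s -> s <= t -> t `^ p <= s `^ p.
Proof.
move=> p0 s0 st; have t0 : 0 < t by exact: lt_le_trans st.
rewrite -(opprK p) !(powRN _ (- p)) lef_pV2 ?posrE ?powR_gt0//.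
by apply: ge0_ler_powR; rewrite ?nnegrE ?oppr_ge0 // ltW.
Qed.

(** The function is [(t / (1 + t)) ^ z], bounded by 1. Its derivative has the singularity
    [t ^ (z - 1)] of the gamma integrand at 0 and decays like [t ^ (-2)] at infinity. *)
Lemma is_derive_gamma_majorant (z t : R) : 0 < t ->
  is_derive t 1 (fun t : R => t `^ z * (1 + t) `^ (- z))
    (z * (t `^ (z - 1) * (1 + t) `^ (- z - 1))).
Proof.
move=> t0.
have t1 : 0 < 1 + t by lra.
have D1 := is_derive1_powR z t0.
have D2 : is_derive t 1 (fun t : R => (1 + t) `^ (- z)) (- z * (1 + t) `^ (- z - 1)).
  have D3 : is_derive t 1 (fun t : R => 1 + t) 1.
    by have := is_deriveD (is_derive_cst (1 : R) t 1) (is_derive_id t 1); rewrite add0r.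
  have D4 := @is_derive1_powR R (- z) (1 + t) t1.
  have := @is_derive1_comp R (fun x : R => x `^ (- z)) (fun t : R => 1 + t) t _ _ D4 D3.
  by rewrite mulr1.
have := is_deriveM D1 D2.
congr (is_derive _ _ _ _).
rewrite /GRing.scale /=.
(* Extracting one factor from [t ^ z] and from [(1 + t) ^ (- z)] gives both terms of the product
   rule the same powers; what is left is [(1 + t) - t = 1]. *)
have E (x p : R) : 0 < x -> x `^ p = x * x `^ (p - 1).
  move=> x0; rewrite -{2}(powRr1 (ltW x0)) -powRD ?subrKC//.
  by rewrite (gt_eqF x0) implybT.
rewrite (E t z t0) (E (1 + t) (- z) t1); ring.
Qed.

(** From [1 + t <= 2 * (1 + t / 2) <= 2 * expR (t / 2)] one gets [(1 + t) ^ 2 <= 4 * expR t], and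
    [-2 <= - z - 1] since [z < 1]. *)
Lemma expRN_le_powR (z t : R) : 0 < z -> z < 1 -> 0 < t ->
  expR (- t) <= 4 * (1 + t) `^ (- z - 1).
Proof.
move=> z0 z1 t0.
have h1 : 1 + t / 2 <= expR (t / 2) by exact: expR_ge1Dx.
have h2 : (1 + t) ^+ 2 <= 4 * expR t.
  rewrite [X in expR X](_ : t = t / 2 + t / 2) ?expRD; last by lra.
  by have := ltW (expR_gt0 (t / 2)); nra.
have h3 : (1 + t) `^ (-2) <= (1 + t) `^ (- z - 1) by rewrite ler_powR//; lra.
apply: (le_trans _ (ler_wpM2l _ h3)) => //.
rewrite powR_invn; last by lra.
rewrite expRN ler_pdivlMr ?exprn_gt0//; last by lra.
by rewrite mulrC ler_pdivrMr ?expR_gt0.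
Qed.

(* A divergent integral would have value [fine +oo = 0], so the positivity
   includes convergence: the integrand is dominated by the derivative of
   [4 / z * (t / (1 + t)) ^ z]. *)
Lemma euler_gamma_gt0 (z : R) : 0 < z -> z < 1 -> 0 < euler_gamma z.
Proof.
move=> z0 z1.
pose f (t : R) := t `^ (z - 1) * expR (- t).
have f_ge0 t : 0 <= f t by rewrite mulr_ge0 ?expR_ge0 ?powR_ge0.
have mf (D : set (measurableTypeR R)) : measurable_fun D f.
  apply: measurable_funTS; apply: measurable_funM; first exact: measurable_powR.
  apply: measurableT_comp => //; exact: measurable_expR.
(* Compact intervals that avoid the singularity at 0, so that the fundamental theorem of calculus
   applies on each. *)
pose A (n : nat) : set (measurableTypeR R) := `[n.+1%:R^-1, n.+2%:R]%classic.
have mA n : measurable (A n) by exact: measurable_itv.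
have AU : `]0, +oo[%classic = \bigcup_n A n.
  apply/seteqP; split => t /=; rewrite ?in_itv/= ?andbT.
    move=> t0; near (\oo : set_system nat) => n; exists n => //.
    rewrite /A /= in_itv/=; apply/andP; split; apply/ltW.
      by near: n; exact: (near_infty_natSinv_lt (PosNum t0)).
    apply: (@lt_le_trans _ _ n%:R); last by rewrite ler_nat -addn2 leq_addr.
    by near: n; exact: nbhs_infty_gtr.
  move=> [n _]; rewrite /A/= in_itv/= => /andP[+ _]; apply: lt_le_trans.
  by rewrite invr_gt0.
(* The bound is uniform in [n] because the primitive [G] takes values in [0, 4 / z]. *)
have Ale n : (\int[mu]_(t in A n) (f t)%:E <= (4 / z)%:E)%E.
  pose G (t : R) := 4 / z * (t `^ z * (1 + t) `^ (- z)).
  pose g (t : R) := 4 * (t `^ (z - 1) * (1 + t) `^ (- z - 1)).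
  have Gd t : 0 < t -> is_derive t 1 G (g t).
    move=> t0; have := is_deriveZ (4 / z) (is_derive_gamma_majorant z t0).
    congr (is_derive _ _ _ _); rewrite /g /GRing.scale /=.
    by field; rewrite gt_eqF.
  have Aab : n.+1%:R^-1 < n.+2%:R :> R.
    by rewrite (@le_lt_trans _ _ 1)// ?invf_le1// ?ler1n ?ltr1n.
  have Apos t : A n t -> 0 < t.
    by rewrite /A/= in_itv/= => /andP[+ _]; apply: lt_le_trans; rewrite invr_gt0.
  have cG t : 0 < t -> {for t, continuous G}.
    by move=> /Gd [H _]; apply/differentiable_continuous/derivable1_diffP.
  have cg t : 0 < t -> {for t, continuous g}.
    move=> t0; apply: (@continuousM _ _ (cst 4)); first exact: cst_continuous.
    apply: continuousM; first exact: continuous_powR.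
    apply: (@continuous_comp _ _ _ (fun t : R => 1 + t) (fun t : R => t `^ (- z - 1))).
      by apply: continuousD; [exact: cst_continuous|exact: id].
    by apply: continuous_powR; lra.
  have fg : (\int[mu]_(t in A n) (f t)%:E <= \int[mu]_(t in A n) (g t)%:E)%E.
    apply: ge0_le_integral => //=.
    - by move=> t _; rewrite lee_fin.
    - by apply/measurable_EFinP; exact: mf.
    - apply/measurable_EFinP; apply: measurable_funM => //.
      apply: measurable_funTS; apply: measurable_funM; first exact: measurable_powR.
      apply: (measurableT_comp (measurable_powR _)); exact: measurable_funD.
    - move=> t /Apos t0; rewrite lee_fin /f /g mulrCA.
      by rewrite ler_wpM2l ?powR_ge0// expRN_le_powR.
  apply: (le_trans fg).
  rewrite (@continuous_FTC2 _ g G)//.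
  - rewrite -EFinB lee_fin (@le_trans _ _ (G n.+2%:R))//.
      by rewrite gerBl /G mulr_ge0 ?divr_ge0 ?(ltW z0)// mulr_ge0 ?powR_ge0.
    rewrite /G ler_piMr ?divr_ge0 ?(ltW z0)// powRN ler_pdivrMr ?powR_gt0//.
    rewrite mul1r; apply: ge0_ler_powR; rewrite ?nnegrE ?(ltW z0)//.
    by rewrite lerDr.
  - apply: continuous_in_subspaceT => t /set_mem At; apply: cg; exact: Apos At.
  - split.
    + move=> t tA; suff /Gd[] : 0 < t by [].
      by apply: Apos; apply: subset_itv_oo_cc tA.
    + by apply/cvg_at_right_filter/cG; rewrite invr_gt0.
    + by apply/cvg_at_left_filter/cG.
  - move=> t tA; have [_] : is_derive t 1 G (g t).
      by apply/Gd/Apos; apply: subset_itv_oo_cc tA.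
    by rewrite derive1E.
have fin : (\int[mu]_(t in `]0%R, +oo[) (f t)%:E <= (4 / z)%:E)%E.
  rewrite AU; apply: ge0_integral_bigcup_le => //.
  - move=> m n mn; apply/subsetPset; apply: subset_itv; rewrite bnd_simp.
      by rewrite lef_pV2 ?posrE// ler_nat.
    by rewrite ler_nat.
  - apply/measurable_EFinP; exact: mf.
  - by move=> t _; rewrite lee_fin.
rewrite /euler_gamma /Rintegral; apply: fine_gt0; apply/andP; split; last first.
  by rewrite (le_lt_trans fin)// ltry.
(* Both factors of the integrand decrease, so on [1, 2] it is at least its value [c] at 2. *)
pose c := 2%:R `^ (z - 1) * expR (- 2).
have c0 : 0 < c by rewrite mulr_gt0 ?expR_gt0 ?powR_gt0.
apply: (@lt_le_trans _ _ (\int[mu]_(t in `[1%R, 2%R]) c%:E)%E).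
  rewrite integral_cst//= lebesgue_measure_itv/= lte_fin ltr1n/= -EFinD -EFinM lte_fin.
  by rewrite mulr_gt0//; lra.
apply: (@le_trans _ _ (\int[mu]_(t in `[1%R, 2%R]) (f t)%:E)%E).
  apply: ge0_le_integral => //=.
  - by move=> t _; rewrite lee_fin ltW.
  - apply/measurable_EFinP; exact: mf.
  - move=> t; rewrite in_itv/= => /andP[t1 t2]; rewrite lee_fin.
    apply: ler_pM; rewrite ?powR_ge0 ?expR_ge0//; last by rewrite ler_expR lerN2.
    by apply: ler_powR_npos => //; lra.
apply: ge0_subset_integral => //=.
- by apply/measurable_EFinP; exact: mf.
- by move=> t _; rewrite lee_fin.
- by move=> t/=; rewrite !in_itv/= => /andP[t1 _]; rewrite andbT; lra.
Unshelve. all: by end_near. Qed.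

(** * The maximum principle *)

(* At a zero [b] of [q] nothing enters from the left and [phi = 0] will do;
   if [q] has no zero on ]-oo, x0], then [phi x] is the integral of [1 / q]
   over [x, x0]. *)
Lemma barrier (q : R -> R) (x0 B : R) :
  continuous q -> (forall x, 0 <= q x) -> inv_diverges_at_ninfty q ->
  exists b, exists phi : R -> R, [/\ b <= x0,
    {within `[b, x0], continuous phi},
    (forall x, b <= x <= x0 -> 0 <= phi x) /\ phi x0 = 0,
    (forall x, b < x <= x0 -> derivable phi x 1 /\ -1 <= q x * derive1 phi x) &
    q b = 0 \/ B <= phi b].
Proof.
move=> cq q0 qdiv.
have [[b [bx0 qb]]|noz] := pselect (exists b, b <= x0 /\ q b = 0).
  exists b, (cst 0); split => //.
  - by apply: continuous_subspaceT => x; exact: cst_continuous.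
  - by move=> x _; split; [exact: derivable_cst|rewrite derive1_cst mulr0 lerN10].
  - by left.
have qpos x : x <= x0 -> 0 < q x.
  move=> xx0; rewrite lt_neqAle q0 andbT; apply/eqP => qx.
  by apply: noz; exists x.
(* Freezing [q] beyond [x0], where it might vanish, makes [f] positive and continuous on the whole
   line. *)
pose f (x : R) := (q (Num.min x x0))^-1.
have f_gt0 x : 0 < f x by rewrite invr_gt0 qpos// ge_min lexx orbT.
have cf : continuous f.
  move=> x; apply: cvgV; first by rewrite gt_eqF// -invr_gt0; exact: f_gt0.
  apply: (@continuous_comp _ _ _ (fun x => Num.min x x0) q); last exact: cq.
  by apply: continuous_min; [exact: id|exact: cst_continuous].
have mf (A : set (measurableTypeR R)) : measurable_fun A f.
  by apply: measurable_funTS; exact: continuous_measurable_fun.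
have iF a b : mu.-integrable `[a, b] (EFin \o f).
  apply: continuous_compact_integrable; first exact: segment_compact.
  exact: continuous_subspaceT.
have [b [bx0 Bb]] : exists b, b < x0 /\ B <= \int[mu]_(x in `[b, x0]) f x.
  apply: contrapT => nB.
  (* Divergence is assumed for tails ending at or before 0, and [f] is [1 / q] up to [x0]; this [X]
     respects both limits. *)
  pose X := Num.min x0 0.
  have := qdiv X; rewrite ge_min lexx orbT => /(_ isT) qX.
  suff : (\int[mu]_(x in `]-oo, X]) `|((q x)%:E)^-1| <= B%:E)%E by rewrite qX leye_eq.
  pose A (n : nat) : set (measurableTypeR R) := `[X - n%:R, X]%classic.
  have mA n : measurable (A n) by exact: measurable_itv.
  have AU : `]-oo, X]%classic = \bigcup_n A n.
    apply/seteqP; split => x /=; rewrite in_itv/=.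
      move=> xX; near (\oo : set_system nat) => n; exists n => //.
      rewrite /A/= in_itv/= xX andbT lerBlDr -lerBlDl; apply/ltW.
      by near: n; exact: nbhs_infty_gtr.
    by move=> [n _]; rewrite /A/= in_itv/= => /andP[].
  have qE x : x <= x0 -> (`|((q x)%:E)^-1| = (f x)%:E)%E.
    move=> xx0; rewrite /f min_l// inver gt_eqF ?qpos// gee0_abs// lee_fin.
    by rewrite invr_ge0.
  have Xx0 : X <= x0 by rewrite ge_min lexx.
  have -> : (\int[mu]_(x in `]-oo, X]) `|((q x)%:E)^-1| = \int[mu]_(x in `]-oo, X]) (f x)%:E)%E.
    by apply: eq_integral => x; rewrite inE/= in_itv/= => xX; rewrite qE// (le_trans xX).
  rewrite AU; apply: ge0_integral_bigcup_le => //.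
  - move=> m n mn; apply/subsetPset; apply: subset_itvr; rewrite bnd_simp.
    by rewrite lerD2l lerN2 ler_nat.
  - by apply/measurable_EFinP; exact: mf.
  - by move=> x _; rewrite lee_fin ltW.
  - move=> n; have i1 := iF (X - n.+1%:R) x0.
    apply: (@le_trans _ _ (\int[mu]_(x in `[(X - n.+1%:R)%R, x0]) (f x)%:E)%E).
      apply: ge0_subset_integral => //=.
      + by apply/measurable_EFinP; exact: mf.
      + by move=> x _; rewrite lee_fin ltW.
      + apply: subset_itv; rewrite bnd_simp//.
        by rewrite lerD2l lerN2 ler_nat.
    rewrite -[leLHS]fineK ?integrable_fin_num// lee_fin.
    rewrite leNgt; apply/negP => /ltW h; apply: nB.
    (* The extra unit in [n.+1] makes the left end strictly smaller than [x0], even when [n = 0] and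
       [X = x0]. *)
    exists (X - n.+1%:R); split => //.
    by rewrite (lt_le_trans _ Xx0)// gtrBl.
(* Starting at [b - 1] instead of [b] makes [G] differentiable at [b] too, which yields continuity
   on the closed interval. *)
pose G x := \int[mu]_(t in `[b - 1, x]) f t.
have Gd x : b - 1 < x -> derivable G x 1 /\ derive1 G x = f x.
  by move=> bx; apply: (@continuous_FTC1_closed R f (b - 1) x (x + 1)); [lra|exact: iF| |exact: cf].
have GB x y : b - 1 < x -> x <= y -> G y - G x = \int[mu]_(t in `[x, y]) f t.
  move=> bx xy; rewrite /G Rintegral_itvB// ?bnd_simp//; last by lra.
  by rewrite Rintegral_itv_obnd_cbnd//; apply: integrableS (iF x y) => //; exact: subset_itv_oc_cc.
have phid x : b - 1 < x -> is_derive x 1 (fun x => G x0 - G x) (- f x).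
  move=> /Gd [dG GE]; have -> : - f x = 0 - derive1 G x by rewrite GE sub0r.
  apply: is_deriveB; rewrite derive1E; exact: DeriveDef.
exists b, (fun x => G x0 - G x); split.
- exact: ltW.
- apply: continuous_in_subspaceT => x /set_mem /=; rewrite in_itv/= => /andP[bx _].
  have [H _] : is_derive x 1 (fun x => G x0 - G x) (- f x) by apply: phid; lra.
  exact/differentiable_continuous/derivable1_diffP.
- split; last by rewrite subrr.
  move=> x /andP[bx xx0]; rewrite GB//; last by lra.
  by apply: Rintegral_ge0 => y _; exact: ltW.
- move=> x /andP[bx xx0].
  have [H HE] : is_derive x 1 (fun x => G x0 - G x) (- f x) by apply: phid; lra.
  split => //; rewrite derive1E HE /f min_l// mulrN divff// gt_eqF//; exact: qpos.
- by right; rewrite GB ?(ltW bx0)//; lra.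
Unshelve. all: by end_near. Qed.

(** Difference quotients with [h < 0] are quotients of nonpositive numbers. Only points to the left
    are compared, so [x] may be the right end of the interval. *)
Lemma derive1_ge0_left_max (f : R -> R) (a x : R) : a < x -> derivable f x 1 ->
  (forall y, a < y <= x -> f y <= f x) -> 0 <= derive1 f x.
Proof.
move=> ax df fmax; rewrite derive1E ['D_1 f x]cvg_at_leftE//.
apply: limr_ge.
  rewrite -(cvg_at_leftE (fun h => h^-1 *: ((f \o shift x) _ - f x)))//.
  apply: cvg_trans df; apply: cvg_app => P [e e0 Pe].
  by exists e => // h he h0; apply: Pe => //; exact/ltr0_neq0.
near=> h; have h0 : h < 0 by near: h; exact: nbhs_left_lt.
rewrite /GRing.scale/= mulr1; apply: mulr_le0; first by rewrite invr_le0 ltW.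
rewrite subr_le0; apply: fmax; rewrite -ltrBlDr; apply/andP; split; last first.
  by rewrite gerDr ltW.
by near: h; apply: nbhs_left_gt; rewrite subr_lt0.
Unshelve. all: by end_near. Qed.

(* Apply the last hypothesis at a maximum point of [u - d * phi] on
   [b, x0] x [0, t0], with [phi] the barrier; the right end [x0] is harmless
   because the left derivative there is nonnegative and [q >= 0]. *)
Lemma strip_maximum_principle (T kappa M K : R) (q : R -> R) (u : R * R -> R) :
  0 < T -> 0 < kappa ->
  continuous q -> (forall x, 0 <= q x) -> inv_diverges_at_ninfty q ->
  {within Omega_closed T, continuous u} ->
  (forall z, Omega T z -> `|u z| <= K) ->
  (forall x, u (x, 0) <= M) ->
  (forall x t, 0 < t < T -> (forall s, 0 <= s <= t -> u (x, s) <= u (x, t)) ->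
    derivable (fun y => u (y, t)) x 1 /\
    kappa * (u (x, t) - u (x, 0)) + q x * derive1 (fun y => u (y, t)) x <= 0) ->
  forall z, Omega T z -> u z <= M.
Proof.
move=> T0 k0 cq q0 qdiv cu ubd uM Hmax [x0 t0] Oz.
rewrite leNgt; apply/negP => Mu.
have /andP[/= t00 t0T] := Oz.
pose c := u (x0, t0) - M.
have c0 : 0 < c by rewrite subr_gt0.
(* With this choice the time term at the maximum is at least [kappa * c = 2 * d], while the barrier
   can offset only [d]. *)
pose d := kappa * c / 2.
have d0 : 0 < d by rewrite divr_gt0// mulr_gt0.
(* On the left edge [d * phi] will reach [2 * K + 1], more than the oscillation of [u], unless
   [q b = 0]. *)
have [b [phi [bx0 cphi [phi0 phix0] dphi bdry]]] := barrier x0 ((2 * K + 1) / d) cq q0 qdiv.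
(* Time stops at [t0 < T], so the differential inequality is still available on the upper edge. *)
pose A : set (R * R) := `[b, x0]%classic `*` `[0, t0]%classic.
pose v (z : R * R) := u z - d * phi z.1.
have AO : A `<=` Omega_closed T.
  move=> [x t] [_ /=]; rewrite in_itv/= /Omega_closed/= => /andP[-> h].
  by rewrite (le_trans h)// ltW.
have cv : {within A, continuous v}.
  apply/subspace_continuousP => z Az; apply: cvgB.
    by move/subspace_continuousP: (continuous_subspaceW AO cu); exact.
  apply: cvgM; first exact: cvg_cst.
  apply: (@cvg_comp _ _ _ fst phi _ (within `[b, x0]%classic (nbhs z.1))); last first.
    by move/subspace_continuousP: cphi; apply; case: Az.
  move=> P /= Pz.
  have H : nbhs z (fun w : R * R => `[b, x0]%classic w.1 -> P w.1).
    exact: (@cvg_fst _ _ (nbhs z.1) (nbhs z.2) _ _ Pz).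
  change (nbhs z (fun w : R * R => A w -> P w.1)).
  by apply: filterS H => w + [wI _]; exact.
have cA : compact A by apply: compact_setX; exact: segment_compact.
have Az : A (x0, t0) by split; rewrite /= in_itv/= ?bx0 ?lexx// ltW.
have [[x t] /set_mem [/= Ax At] vmax] := compact_EVT_max (ex_intro _ _ Az) cA cv.
rewrite /= !in_itv/= in Ax At.
have /andP[bx xx0] := Ax; have /andP[tge0 tt0] := At.
have vz : u (x0, t0) <= v (x, t).
  by have := vmax _ (mem_set Az); rewrite /v/= phix0 mulr0 subr0.
have phix : 0 <= phi x by exact: phi0.
have dphix : 0 <= d * phi x by rewrite mulr_ge0// ltW.
have uz : u (x0, t0) <= u (x, t) by move: vz; rewrite /v/=; lra.
have t_gt0 : 0 < t.
  rewrite lt_neqAle tge0 andbT; apply/eqP => t_eq0.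
  by move: uz; rewrite -t_eq0; have := uM x; lra.
have tT : 0 < t < T by rewrite t_gt0 (le_lt_trans tt0).
have [] := Hmax x t tT.
  (* The barrier does not depend on time, so a maximum of [v] is also a maximum in time of [u]. *)
  move=> s /andP[s0 st].
  have : v (x, s) <= v (x, t).
    by apply/vmax/mem_set; split; rewrite /= in_itv//= s0 (le_trans st).
  by rewrite /v/= lerD2r.
move=> du ineq.
have ineq2 : q x * derive1 (fun y => u (y, t)) x <= - (2 * d).
  have h1 : kappa * c <= kappa * (u (x, t) - u (x, 0)).
    by rewrite ler_pM2l// /c; have := uM x; lra.
  by move: ineq; rewrite /d; lra.
(* The left edge is excluded: if [q b = 0], then [ineq2] reads [0 <= - (2 * d)]; otherwise the
   height of the barrier contradicts [vz]. *)
have [xb|bltx] : x = b \/ b < x.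
  by move: bx; rewrite le_eqVlt => /predU1P[->|]; [left|right].
  case: bdry => [qb|Bphi].
    by move: ineq2; rewrite xb qb mul0r; lra.
  have h1 : 2 * K + 1 <= d * phi x by rewrite xb [leRHS]mulrC -ler_pdivrMr.
  have := ubd _ Oz; have := ubd (x, t) tT; rewrite !ler_norml => /andP[_ h2] /andP[h3 _].
  by move: vz; rewrite /v/=; lra.
have [dphix1 qphi] := dphi x (introT andP (conj bltx xx0)).
have dvx : is_derive x 1 (fun y => v (y, t))
    (derive1 (fun y => u (y, t)) x - d * derive1 phi x).
  rewrite !derive1E.
  exact: (is_deriveB (DeriveDef du erefl) (is_deriveZ d (DeriveDef dphix1 erefl))).
have : 0 <= derive1 (fun y => v (y, t)) x.
  apply: (@derive1_ge0_left_max _ b) => //.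
  move=> y /andP[by_ yx]; apply/vmax/mem_set; split; rewrite /= in_itv/=.
    by rewrite ltW//= (le_trans yx).
  by rewrite tge0.
rewrite derive1E; have [_ ->] := dvx => h.
(* Multiplying by [q x >= 0] gives [q u_x >= d q phi' >= - d], against the bound [- (2 * d)]. *)
have : 0 <= q x * (derive1 (fun y => u (y, t)) x - d * derive1 phi x).
  by rewrite mulr_ge0.
have : - d <= d * (q x * derive1 phi x) by rewrite -[leLHS]mulrN1 ler_pM2l.
by move: ineq2; lra.
Qed.

(** * Weak derivatives of continuous functions *)

(** The square of the positive part, a C^1 function; in this form its difference quotient at 0 is
    simply [Num.max h 0]. *)
Definition pos_sqr (x : R) : R := x * Num.max x 0.

(** The tent supported on [0, 2] with peak 1 at 1, as a second difference of the positive part. *)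
Definition hat (x : R) : R :=
  Num.max x 0 - 2 * Num.max (x - 1) 0 + Num.max (x - 2) 0.

(* A C^1 primitive of the hat function of integral 1 supported on [c, c + 2 h]. *)
Definition ramp (c h x : R) : R :=
  2^-1 * (pos_sqr ((x - c) / h) - 2 * pos_sqr ((x - c) / h - 1)
          + pos_sqr ((x - c) / h - 2)).

Lemma pos_sqr_derive (x : R) : is_derive x 1 pos_sqr (2 * Num.max x 0).
Proof.
have [x0|x0|->] := ltgtP x 0.
- rewrite mulr0; apply: near_eq_is_derive (is_derive_cst (0 : R) x 1).
  near=> y; rewrite /pos_sqr max_r ?mulr0//; apply/ltW.
  by near: y; exact: lt_nbhsl.
- apply: (@near_eq_is_derive _ _ _ (fun y : R => y * y)).
    near=> y; rewrite /pos_sqr max_l//; apply/ltW.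
    by near: y; exact: lt_nbhsr.
  have := is_deriveM (is_derive_id x 1) (is_derive_id x 1).
  congr (is_derive _ _ _ _).
  by rewrite /GRing.scale/=; ring.
- rewrite mulr0.
  have H : (h^-1 *: ((pos_sqr \o shift 0) (h *: 1) - pos_sqr 0))
      @[h --> (0 : R)^'] --> (0 : R).
    have M0 : Num.max h 0 @[h --> (0 : R)^'] --> (0 : R).
      have C : {for (0 : R), continuous (fun h : R => Num.max h 0)}.
        by apply: continuous_max; [exact: id|exact: cst_continuous].
      by apply: cvg_within_filter; rewrite /prop_for /continuous_at maxxx in C.
    apply: cvg_trans M0; apply: near_eq_cvg; near=> h.
    have h0 : h != 0 by near: h; exact: nbhs_dnbhs_neq.
    by rewrite /pos_sqr /GRing.scale/= mulr1 addr0 mul0r subr0 mulrA mulVf// mul1r.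
  apply: DeriveDef; first by apply/cvg_ex; exists 0.
  by rewrite /derive; exact/cvg_lim.
Unshelve. all: by end_near. Qed.

Lemma ramp_derive (c h x : R) :
  is_derive x 1 (ramp c h) (h^-1 * hat ((x - c) / h)).
Proof.
have D (k : R) : is_derive x 1 (fun y => pos_sqr ((y - c) / h - k))
    (2 * Num.max ((x - c) / h - k) 0 * h^-1).
  have A : is_derive x 1 (fun y => (y - c) / h - k) h^-1.
    have -> : (fun y => (y - c) / h - k) = (h^-1 \*: (id - cst c)) - cst k.
      by apply/funext => y; rewrite mulrC.
    have := is_deriveB (is_deriveZ h^-1 (is_deriveB (is_derive_id x 1) (is_derive_cst c x 1)))
      (is_derive_cst k x 1).
    by rewrite !subr0 /GRing.scale/= mulr1.
  exact: (@is_derive1_comp R pos_sqr _ x _ _ (pos_sqr_derive _) A).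
have -> : ramp c h = 2^-1 \*: ((fun y => pos_sqr ((y - c) / h - 0))
   - 2 \*: (fun y => pos_sqr ((y - c) / h - 1)) + (fun y => pos_sqr ((y - c) / h - 2))).
  by apply/funext => y; rewrite /ramp -[X in _ * (pos_sqr X - _ + _)]subr0.
have := is_deriveZ 2^-1 (is_deriveD (is_deriveB (D 0) (is_deriveZ 2 (D 1))) (D 2)).
congr (is_derive _ _ _ _); rewrite /hat /GRing.scale/= subr0.
by move: (h^-1) => w; field.
Qed.

Lemma hat_ge0 (x : R) : 0 <= hat x.
Proof.
rewrite /hat; case: (lerP x 0); case: (lerP (x - 1) 0); case: (lerP (x - 2) 0); lra.
Qed.

Lemma hat_le1 (x : R) : hat x <= 1.
Proof.
rewrite /hat; case: (lerP x 0); case: (lerP (x - 1) 0); case: (lerP (x - 2) 0); lra.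
Qed.

Lemma hat_eq0 (x : R) : x <= 0 \/ 2 <= x -> hat x = 0.
Proof.
rewrite /hat => -[] ?; case: (lerP x 0); case: (lerP (x - 1) 0); case: (lerP (x - 2) 0); lra.
Qed.

Lemma continuous_hat : continuous hat.
Proof.
have C (k x : R) : {for x, continuous (fun y : R => Num.max (y - k) 0)}.
  apply: continuous_max; last exact: cst_continuous.
  by apply: continuousB; [exact: id|exact: cst_continuous].
have -> : hat = (fun y => Num.max (y - 0) 0) - (fun y => 2 * Num.max (y - 1) 0)
    + (fun y => Num.max (y - 2) 0).
  by apply/funext => y; rewrite /hat -[X in Num.max X _ - _]subr0.
move=> x; apply: continuousD; last exact: C.
apply: continuousB; first exact: C.
by apply: (@continuousM _ _ (cst 2)); [exact: cst_continuous|exact: C].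
Qed.

Lemma ramp_eq0 (c h x : R) : 0 < h -> x <= c -> ramp c h x = 0.
Proof.
move=> h0 xc; have y0 : (x - c) / h <= 0 by rewrite pmulr_lle0 ?invr_gt0// subr_le0.
by rewrite /ramp /pos_sqr !max_r; lra.
Qed.

Lemma ramp_eq1 (c h x : R) : 0 < h -> c + 2 * h <= x -> ramp c h x = 1.
Proof.
move=> h0 xc; have y0 : 2 <= (x - c) / h by rewrite ler_pdivlMr//; lra.
by rewrite /ramp /pos_sqr !max_l; try lra; field.
Qed.

Lemma ramp_ge0_le1 (c h x : R) : 0 <= ramp c h x <= 1.
Proof.
rewrite /ramp; set y := (x - c) / h; rewrite /pos_sqr.
by case: (lerP y 0); case: (lerP (y - 1) 0); case: (lerP (y - 2) 0); nra.
Qed.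

Lemma continuous_scaled_hat (c h : R) : continuous (fun x : R => h^-1 * hat ((x - c) / h)).
Proof.
move=> x; apply: (@continuousM _ _ (fun=> h^-1) (fun x => hat ((x - c) / h))).
  exact: cst_continuous.
apply: (@continuous_comp _ _ _ (fun x : R => (x - c) / h) hat); last exact: continuous_hat.
apply: continuousM; last exact: cst_continuous.
by apply: continuousB; [exact: id|exact: cst_continuous].
Qed.

Lemma continuous_ramp (c h : R) : continuous (ramp c h).
Proof.
move=> x; apply/differentiable_continuous/derivable1_diffP.
exact: (@ex_derive _ _ _ _ _ _ _ (ramp_derive c h x)).
Qed.

(** The primitive [ramp c h] is 0 at [a] and 1 at [b]. *)
Lemma Rintegral_scaled_hat (a b c h : R) : a < c -> 0 < h -> c + 2 * h < b ->
  \int[mu]_(x in `]a, b[) (h^-1 * hat ((x - c) / h)) = 1.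
Proof.
move=> ac h0 chb.
have ab : a < b by lra.
have ic : mu.-integrable `[a, b] (EFin \o (fun x => h^-1 * hat ((x - c) / h))).
  apply: continuous_compact_integrable; first exact: segment_compact.
  exact/continuous_subspaceT/continuous_scaled_hat.
rewrite Rintegral_itv_bndo_bndc; last first.
  by apply: integrableS ic => //; exact: subset_itv_oo_cc.
rewrite Rintegral_itv_obnd_cbnd; last first.
  by apply: integrableS ic => //; exact: subset_itv_oc_cc.
rewrite /Rintegral (@continuous_FTC2 _ _ (ramp c h))//.
- by rewrite ramp_eq1 ?ramp_eq0 ?ltW//= subr0.
- exact/continuous_subspaceT/continuous_scaled_hat.
- split.
  + by move=> x _; exact: (@ex_derive _ _ _ _ _ _ _ (ramp_derive c h x)).
  + exact/cvg_at_right_filter/continuous_ramp.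
  + exact/cvg_at_left_filter/continuous_ramp.
- by move=> x _; rewrite derive1E; have [_ ->] := ramp_derive c h x.
Qed.

Lemma measurable_scaled_hat (c h : R) (D : set (measurableTypeR R)) :
  measurable_fun D (fun x : R => h^-1 * hat ((x - c) / h)).
Proof.
by apply: measurable_funTS; apply: continuous_measurable_fun; exact: continuous_scaled_hat.
Qed.

Lemma integrable_scaled_hat (c h : R) (D : set (measurableTypeR R)) (f : R -> R) :
  measurable D -> 0 < h -> mu.-integrable D (EFin \o f) ->
  mu.-integrable D (EFin \o (fun x => f x * (h^-1 * hat ((x - c) / h)))).
Proof.
move=> mD h0 intf.
have mf : measurable_fun D f by have /integrableP[/measurable_EFinP] := intf.
apply: (le_integrable mD _ _ (integrable_scale h^-1 mD intf)).
- apply/measurable_EFinP; apply: measurable_funM => //.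
  exact: measurable_scaled_hat.
- move=> x _ /=; rewrite lee_fin normrM [leRHS]normrM mulrC ler_wpM2r//.
  have hn : 0 <= h^-1 by rewrite invr_ge0 ltW.
  by rewrite ger0_norm ?(ger0_norm hn) ?mulr_ge0 ?hat_ge0// ler_piMr ?hat_le1.
Qed.

(** The scaled hats form a one-sided approximate identity: they have mass 1 and supports
    [[c, c + 2 * h n]] that shrink to [c]. *)
Lemma scaled_hat_cvg (a b c : R) (f : R -> R) (h : nat -> R) :
  a < c -> mu.-integrable `]a, b[ (EFin \o f) -> {for c, continuous f} ->
  (forall n, 0 < h n) -> (forall n, c + 2 * h n < b) -> h n @[n --> \oo] --> 0 ->
  \int[mu]_(x in `]a, b[) (f x * ((h n)^-1 * hat ((x - c) / h n))) @[n --> \oo] --> f c.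
Proof.
move=> ac if_ fc h0 hb hcvg.
set I : set (measurableTypeR R) := `]a, b[%classic.
have mI : measurable I by exact: measurable_itv.
pose e n x := (h n)^-1 * hat ((x - c) / h n).
have e0 n x : 0 <= e n x by rewrite mulr_ge0 ?hat_ge0// invr_ge0 ltW.
have ifin (k : R) : mu.-integrable I (EFin \o cst k).
  have H : mu.-integrable `[a, b] (EFin \o cst k).
    apply: continuous_compact_integrable; first exact: segment_compact.
    by apply: continuous_subspaceT => x; exact: cst_continuous.
  by apply: integrableS H => //; exact: subset_itv_oo_cc.
have ibound (g : R -> R) n : mu.-integrable I (EFin \o g) ->
    mu.-integrable I (EFin \o (fun x => g x * e n x)).
  by move=> ig; exact: integrable_scaled_hat.
apply/cvgrPdist_le => d d0.
have [r /= r0 fr] : exists2 r : R, 0 < r & forall x, `|c - x| < r -> `|f c - f x| <= d.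
  have /cvgrPdist_le/(_ d d0)/nbhs_ballP[r /= r0 H] := fc.
  by exists r => // x xr; exact: H.
near=> n.
have hr : 2 * h n < r.
  near: n; have r2 : 0 < r / 2 by rewrite divr_gt0.
  have /cvgrPdist_lt/(_ _ r2) := hcvg; apply: filterS => n.
  by rewrite sub0r normrN gtr0_norm//; lra.
(* Mass 1 turns [f c] into an integral against the same kernel, so only the difference [f c - f x]
   near [c] has to be estimated. *)
have -> : f c = \int[mu]_(x in I) (f c * e n x).
  rewrite RintegralZl//; last by have := ibound _ n (ifin 1); under eq_fun do rewrite mul1r.
  by rewrite Rintegral_scaled_hat// mulr1.
rewrite -RintegralB//; last 2 first.
- exact: (ibound (cst (f c)) n (ifin _)).
- exact: ibound.
have iB : mu.-integrable I (EFin \o (fun x => f c * e n x - f x * e n x)).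
  by apply: (integrableB mI (ibound (cst (f c)) n (ifin _)) (ibound _ n if_)).
apply: (le_trans (le_normr_Rintegral _ _)) => //.
apply: (@le_trans _ _ (\int[mu]_(x in I) (d * e n x))).
  apply: le_Rintegral => //.
  - exact: (integrable_norm iB).
  - exact: (ibound (cst d) n (ifin _)).
  - move=> x Ix; rewrite -mulrBl normrM [`|e n x|]ger0_norm//.
    have [xin|xout] := ltP `|c - x| r; first by rewrite ler_wpM2r// fr.
    rewrite /e hat_eq0 ?mulr0//.
    have [xc|cx] := leP x c; [left|right].
      by rewrite pmulr_lle0 ?invr_gt0// subr_le0.
    move: xout; rewrite ler_pdivlMr// ltr0_norm; last by lra.
    by lra.
rewrite RintegralZl//; last by have := ibound _ n (ifin 1); under eq_fun do rewrite mul1r.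
by rewrite Rintegral_scaled_hat// mulr1.
Unshelve. all: by end_near. Qed.

(* Tested against [ramp r h - ramp s h], which tends to the indicator of
   ]r, s] as [h] tends to 0. *)
Lemma weak_derivative_increment (a b r s : R) (f g : R -> R) :
  mu.-integrable `]a, b[ (EFin \o f) -> mu.-integrable `]a, b[ (EFin \o g) ->
  is_weak_derivative `]a, b[ f g -> a < r -> r < s -> s < b ->
  {for r, continuous f} -> {for s, continuous f} ->
  f s - f r = \int[mu]_(x in `]r, s[) g x.
Proof.
move=> if_ ig fg ar rs sb fr fs.
set I : set (measurableTypeR R) := `]a, b[%classic.
have mI : measurable I by exact: measurable_itv.
have mg : measurable_fun I g by have /integrableP[/measurable_EFinP] := ig.
(* The factor [(b - s) / 4] keeps [s + 2 * h n] at most the midpoint of [s, b], so the test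
   functions have support inside ]a, b[. *)
pose h (n : nat) : R := (b - s) / 4 * n.+1%:R^-1.
have h0 n : 0 < h n by rewrite mulr_gt0 ?invr_gt0// divr_gt0// subr_gt0.
have hle n : h n <= (b - s) / 4.
  by rewrite ler_piMr ?invf_le1 ?ler1n// divr_ge0// subr_ge0 ltW.
have hcvg : h n @[n --> \oo] --> (0 : R).
  rewrite -[X in _ --> X](mulr0 ((b - s) / 4)).
  by apply: cvgM; [exact: cvg_cst|exact: cvg_harmonic].
have hsmall d : 0 < d -> \forall n \near \oo, 2 * h n <= d.
  move=> d0; have d2 : 0 < d / 2 by rewrite divr_gt0.
  have /cvgrPdist_lt/(_ _ d2) := hcvg; apply: filterS => n.
  by rewrite sub0r normrN gtr0_norm//; lra.
have hs n : s + 2 * h n < b by have := hle n; lra.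
have hr n : r + 2 * h n < b by have := hs n; lra.
pose phi n x := ramp r (h n) x - ramp s (h n) x.
have dphi n x : is_derive x 1 (phi n) ((h n)^-1 * hat ((x - r) / h n)
    - (h n)^-1 * hat ((x - s) / h n)).
  exact: (is_deriveB (ramp_derive r (h n) x) (ramp_derive s (h n) x)).
have dphiE n : derive1 (phi n) = fun x => (h n)^-1 * hat ((x - r) / h n)
    - (h n)^-1 * hat ((x - s) / h n).
  by apply/funext => x; rewrite derive1E; have [_ ->] := dphi n x.
have tphi n : test_function I (phi n).
  split.
  - by move=> x; exact: (@ex_derive _ _ _ _ _ _ _ (dphi n x)).
  - rewrite dphiE => x.
    exact: (continuousB (@continuous_scaled_hat r (h n) x) (@continuous_scaled_hat s (h n) x)).
  (* To the left of [r] both ramps vanish; to the right of [s + 2 * h n] both equal 1 and cancel. *)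
  - exists `[r, s + 2 * h n]%classic; split; first exact: segment_compact.
      by apply: subset_itv; rewrite bnd_simp.
    move=> x /=; rewrite in_itv/= => /negP; rewrite negb_and -!ltNge.
    move=> /orP[xr|sx]; rewrite /phi.
      by rewrite !ramp_eq0 ?subrr//; lra.
    by rewrite !ramp_eq1 ?subrr//; have := h0 n; lra.
have phi_le1 n x : `|phi n x| <= 1.
  have /andP[? ?] := ramp_ge0_le1 r (h n) x; have /andP[? ?] := ramp_ge0_le1 s (h n) x.
  by rewrite /phi ler_norml; lra.
have Lf : \int[mu]_(x in I) (f x * derive1 (phi n) x) @[n --> \oo] --> f r - f s.
  have E n : \int[mu]_(x in I) (f x * derive1 (phi n) x) =
      \int[mu]_(x in I) (f x * ((h n)^-1 * hat ((x - r) / h n))) -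
      \int[mu]_(x in I) (f x * ((h n)^-1 * hat ((x - s) / h n))).
    rewrite -RintegralB//; first last.
    - exact: integrable_scaled_hat.
    - exact: integrable_scaled_hat.
    by apply: eq_Rintegral => x _; rewrite dphiE mulrBr.
  under eq_fun do rewrite E.
  by apply: cvgB; apply: scaled_hat_cvg => //; lra.
(* Each ramp is 0 at its own starting point, so the pointwise limit excludes [r] and includes
   [s]. *)
have Lg : \int[mu]_(x in I) (g x * phi n x) @[n --> \oo] -->
    \int[mu]_(x in I) (g x * \1_`]r, s] x).
  apply: (@Rdominated_cvg I _ _ (fun x => `|g x|)) => //.
  - move=> n; apply: measurable_funM => //; apply: measurable_funTS.
    apply: continuous_measurable_fun => x.
    exact: (continuousB (@continuous_ramp r (h n) x) (@continuous_ramp s (h n) x)).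
  - exact: measurable_funM.
  - move=> x Ix; apply: cvgM; first exact: cvg_cst.
    apply: cvg_near_cst; rewrite indicE mem_setE in_itv/=.
    have [xr|rx] := leP x r.
      by apply: nearW => n; rewrite /phi !ramp_eq0 ?subrr//; lra.
    have [xs|sx] := leP x s.
      near=> n; rewrite /phi ramp_eq1 ?ramp_eq0 ?subr0// -lerBrDl.
      by near: n; apply: hsmall; rewrite subr_gt0.
    near=> n; rewrite /phi !ramp_eq1 ?subrr// -lerBrDl.
      by near: n; apply: hsmall; rewrite subr_gt0.
    by near: n; apply: hsmall; rewrite subr_gt0.
  - exact: (integrable_norm ig).
  - by move=> n x _; rewrite normrM ler_piMr.
have LE : \int[mu]_(x in I) (f x * derive1 (phi n) x) @[n --> \oo] -->
    - \int[mu]_(x in I) (g x * \1_`]r, s] x).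
  under eq_fun do rewrite (fg _ (tphi _)).
  exact: cvgN.
have H : f r - f s = - \int[mu]_(x in I) (g x * \1_`]r, s] x) by exact: cvg_unique Lf LE.
rewrite -opprB {}H opprK.
rewrite (_ : \int[mu]_(x in I) _ = \int[mu]_(x in `]r, s]) g x); last first.
  rewrite (_ : `]r, s]%classic = I `&` `]r, s]%classic); last first.
    rewrite setIidr//; apply: subset_itv; rewrite bnd_simp//.
    exact: ltW.
  rewrite Rintegral_mkcondr; apply: eq_Rintegral => x /set_mem Ix.
  rewrite patchE indicE in_setI (mem_set Ix) /=; by case: (x \in _); rewrite ?mulr1 ?mulr0.
rewrite -Rintegral_itv_bndo_bndc//; apply: integrableS ig => //.
by apply: subset_itv; rewrite bnd_simp ltW.
Unshelve. all: by end_near. Qed.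

(** This links the weak derivative to the pointwise [derive1] of the Caputo integrand: both agree
    almost everywhere with the density [g] of the increments of [f]. *)
Lemma W11_primitive (T : R) (f : R -> R) : 0 < T ->
  {within `[0, T], continuous f} -> W11 `]0, T[ f ->
  exists g : R -> R, [/\ mu.-integrable setT (EFin \o g),
    (forall r s, 0 <= r -> r < s -> s < T -> f s - f r = \int[mu]_(x in `]r, s[) g x) &
    {ae mu, forall x, 0 < x < T -> derive1 f x = g x}].
Proof.
move=> T0 /(continuous_within_itvP _ T0)[cf cf0 _] [if_ [g0 [ig0 fg0]]].
set I : set (measurableTypeR R) := `]0, T[%classic in if_ ig0 fg0.
have mI : measurable I by exact: measurable_itv.
(* Extension by zero makes [g] integrable on the whole line, where Lebesgue differentiation is
   applied. *)
pose g := g0 \_ I.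
have gE x : I x -> g x = g0 x by move=> Ix; rewrite /g patchE mem_set.
have ig : mu.-integrable setT (EFin \o g).
  rewrite /g -restrict_EFin; apply/(integrable_mkcond _ mI).1 => //.
have igS (A : set (measurableTypeR R)) : measurable A -> mu.-integrable A (EFin \o g).
  by move=> mA; apply: integrableS ig.
have fg : is_weak_derivative I f g.
  move=> phi tphi; rewrite (fg0 phi tphi); congr (- _).
  by apply: eq_Rintegral => x /set_mem Ix; rewrite gE.
have fgE r s : 0 < r -> r < s -> s < T -> f s - f r = \int[mu]_(x in `]r, s[) g x.
  move=> r0 rs sT; apply: (@weak_derivative_increment 0 T) => //.
  - exact: igS.
  - by apply: cf; rewrite in_itv/= r0/= (lt_trans rs).
  - by apply: cf; rewrite in_itv/= sT (lt_trans r0).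
pose G x := \int[mu]_(t in `[0, x]) g t.
have GE r s : 0 <= r -> r < s -> G s - G r = \int[mu]_(x in `]r, s[) g x.
  move=> r0 rs; rewrite /G Rintegral_itvB ?bnd_simp//; last exact: ltW.
    by rewrite -Rintegral_itv_bndo_bndc//; exact: igS.
  exact: igS.
(* The increment formula holds for [r > 0]; right continuity of [f] and [G] at 0 extends it to
   [r = 0]. *)
have fG s : 0 < s -> s < T -> f s - f 0 = G s.
  move=> s0 sT.
  have L1 : f s - f r @[r --> 0^'+] --> f s - f 0 by apply: cvgB; [exact: cvg_cst|exact: cf0].
  have L2 : G s - G r @[r --> 0^'+] --> G s.
    rewrite -[X in _ --> X]subr0; apply: cvgB; first exact: cvg_cst.
    apply: cvg_at_right_filter.
    by apply: (@parameterized_integral_cvg_left R 0 T) => //; exact: igS.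
  suff L3 : f s - f r @[r --> 0^'+] --> G s by exact: (cvg_unique _ L1 L3).
  apply: cvg_trans L2; apply: near_eq_cvg; near=> r.
  have r0 : 0 < r by near: r; exact: nbhs_right_gt.
  have rs : r < s by near: r; exact: nbhs_right_lt.
  by rewrite GE ?(ltW r0)// -fgE.
exists g; split => //.
  move=> r s; rewrite le_eqVlt => /predU1P[<- s0 sT|]; last exact: fgE.
  by rewrite fG// -GE// /G set_itv1 Rintegral_set1 subr0.
have lg : locally_integrable setT g.
  by apply: open_integrable_locally => //; exact: openT.
(* Lebesgue differentiation: [G] has derivative [g] almost everywhere, and on ]0, T[ the function
   [f] is [G] plus the constant [f 0]. *)
have := @FTC1 R g (BLeft 0) (fun y => igS _ (measurable_itv _)) lg.
apply: filterS; first exact: (ae_filter_ringOfSetsType mu).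
move=> x /= H /andP[x0 xT].
have [|dG <-] := H; first by rewrite lte_fin.
rewrite !derive1E; transitivity ('D_1 (G + cst (f 0)) x).
  apply: near_eq_derive; near=> y.
  have y0 : 0 < y by near: y; exact: lt_nbhsr.
  have yT : y < T by near: y; exact: lt_nbhsl.
  by rewrite -[f y](subrK (f 0)) fG.
by rewrite deriveD// derive_cst addr0.
Unshelve. all: by end_near. Qed.

(** * The Caputo derivative at an extremum *)

Lemma measurable_caputo_kernel (t p : R) (D : set (measurableTypeR R)) :
  measurable_fun D (fun s => (t - s) `^ p).
Proof.
apply: measurable_funTS; apply: (measurableT_comp (measurable_powR p)).
exact: measurable_funB.
Qed.

Lemma W11_derive1_primitive (T alpha t : R) (f : R -> R) :
  0 < alpha -> 0 < t < T ->
  {within `[0, T], continuous f} -> W11 `]0, T[ f -> caputo_defined alpha f t ->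
  mu.-integrable `]0, t[ (EFin \o derive1 f) /\
  forall r, 0 <= r < t -> \int[mu]_(s in `]r, t[) derive1 f s = f t - f r.
Proof.
move=> a0 /andP[t0 tT] cf Wf cap.
have T0 : 0 < T by exact: lt_trans tT.
have [g [ig fgE fae]] := W11_primitive T0 cf Wf.
set I : set (measurableTypeR R) := `]0, t[%classic.
have mI : measurable I by exact: measurable_itv.
have ts s : I s -> 0 < t - s by rewrite /I/= in_itv/= subr_gt0 => /andP[].
(* Measurability of [derive1 f] is read off the Caputo integrand by multiplying it by
   [(t - s) ^ alpha], which cancels the kernel. *)
have mD : measurable_fun I (derive1 f).
  apply: (eq_measurable_fun (fun s => (t - s) `^ alpha * caputo_integrand alpha f t s)).
    move=> s /set_mem Is; rewrite /caputo_integrand mulrA powRN mulfV ?mul1r//.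
    by rewrite gt_eqF// powR_gt0// ts.
  apply: measurable_funM; first exact: measurable_caputo_kernel.
  by apply/measurable_EFinP; exact: (measurable_int mu cap).
(* The kernel is at least [t ^ (- alpha)], so [derive1 f] is dominated by [t ^ alpha] times the
   Caputo integrand. *)
have iD : mu.-integrable I (EFin \o derive1 f).
  apply: (le_integrable mI _ _ (integrable_scale (t `^ alpha) mI cap)).
    exact/measurable_EFinP.
  move=> s Is /=; rewrite lee_fin /caputo_integrand mulrA normrM ler_peMl//.
  rewrite ger0_norm ?mulr_ge0 ?powR_ge0// powRN ler_pdivlMr ?powR_gt0 ?ts// mul1r.
  have st : t - s <= t by move: Is; rewrite /I/= in_itv/= => /andP[s0 _]; lra.
  by apply: ge0_ler_powR; rewrite ?nnegrE// ltW// ts.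
split=> // r /andP[r0 rt]; rewrite (fgE r t)//.
rewrite /Rintegral; congr fine.
have sI : `]r, t[%classic `<=` I by apply: subset_itvr; rewrite bnd_simp.
apply: ae_eq_integral => //.
- by apply/measurable_EFinP; exact: (measurable_funS mI sI mD).
- exact: (measurable_funS measurableT (@subsetT _ _) (measurable_int mu ig)).
- apply: filterS fae; first exact: (ae_filter_ringOfSetsType mu).
  move=> s /= H /sI; rewrite /I/= in_itv/= => /andP[s0 st].
  by rewrite H// s0 (lt_trans st).
Qed.

Lemma caputo_ge_at_max (T alpha t : R) (f : R -> R) :
  0 < alpha -> alpha < 1 -> 0 < t < T ->
  {within `[0, T], continuous f} -> W11 `]0, T[ f -> caputo_defined alpha f t ->
  (forall s, 0 <= s <= t -> f s <= f t) ->
  (euler_gamma (1 - alpha))^-1 * (t `^ (- alpha) * (f t - f 0)) <= caputo alpha f t.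
Proof.
move=> a0 a1 tT cf Wf cap fmax.
have [iD DE] := W11_derive1_primitive a0 tT cf Wf cap.
have /andP[t0 _] := tT.
rewrite /caputo ler_pM2l ?invr_gt0 ?euler_gamma_gt0//; [|lra|lra].
rewrite /caputo_integrand.
(* Here [k0 = t ^ (- alpha)] is the value at [s = 0] of the kernel, which increases with [s]. *)
apply: monotone_kernel_Rintegral_ge => //.
- exact: measurable_caputo_kernel.
- by move=> s /andP[s0 st]; apply: ler_powR_npos; lra.
- by move=> r s r0 rs st; apply: ler_powR_npos; lra.
- by move=> r /andP[r0 rt]; rewrite fmax// r0 ltW.
Qed.

(** The kernel inequality is applied to [\- f] with density [-1 * derive1 f], so the pointwise
    derivative of [- f] is never formed. *)
Lemma caputo_le_at_min (T alpha t : R) (f : R -> R) :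
  0 < alpha -> alpha < 1 -> 0 < t < T ->
  {within `[0, T], continuous f} -> W11 `]0, T[ f -> caputo_defined alpha f t ->
  (forall s, 0 <= s <= t -> f t <= f s) ->
  caputo alpha f t <= (euler_gamma (1 - alpha))^-1 * (t `^ (- alpha) * (f t - f 0)).
Proof.
move=> a0 a1 tT cf Wf cap fmin.
have [iD DE] := W11_derive1_primitive a0 tT cf Wf cap.
have /andP[t0 _] := tT.
have mI : measurable (`]0, t[%classic : set (measurableTypeR R)) by exact: measurable_itv.
rewrite /caputo ler_pM2l ?invr_gt0 ?euler_gamma_gt0//; [|lra|lra].
rewrite -lerN2 -mulrN opprB.
have -> : f 0 - f t = (\- f) t - (\- f) 0 by rewrite /=; ring.
have -> : - (\int[mu]_(s in `]0, t[) caputo_integrand alpha f t s) =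
    \int[mu]_(s in `]0, t[) ((t - s) `^ (- alpha) * (-1 * derive1 f s)).
  rewrite -[LHS]mulN1r -(RintegralZl _ mI cap).
  by apply: eq_Rintegral => s _; rewrite /caputo_integrand; ring.
apply: monotone_kernel_Rintegral_ge => //.
- exact: integrable_scale.
- rewrite (_ : (fun s => _) = (fun s => -1 * caputo_integrand alpha f t s)).
    exact: integrable_scale.
  by apply/funext => s; rewrite /caputo_integrand; ring.
- exact: measurable_caputo_kernel.
- by move=> s /andP[s0 st]; apply: ler_powR_npos; lra.
- by move=> r s r0 rs st; apply: ler_powR_npos; lra.
- move=> r /andP[r0 rt]; rewrite RintegralZl//; last first.
    by apply: integrableS iD => //; apply: subset_itvr; rewrite bnd_simp.
  by rewrite DE ?r0//=; ring.
- by move=> r /andP[r0 rt]/=; rewrite lerN2 fmin// r0 ltW.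
Qed.

(** * Suprema over the strip *)

Lemma open_Omega (T : R) : open (@Omega R T).
Proof.
rewrite (_ : @Omega R T = snd @^-1` `]0, T[%classic).
  by apply: open_comp => // z _; exact: cvg_snd.
by apply/seteqP; split => z /=; rewrite in_itv.
Qed.

(** If [|u z|] exceeded the essential bound, it would do so on a whole ball by continuity. That ball
    is a product of two intervals, has positive measure and would lie in a null set. *)
Lemma continuous_Linfty_bounded (T : R) (u : R * R -> R) :
  {within @Omega_closed R T, continuous u} -> Linfty (@Omega R T) u ->
  exists K, forall z, Omega T z -> `|u z| <= K.
Proof.
move=> cu [_ [M [N [mN N0 MN]]]]; exists M => z Oz.
rewrite leNgt; apply/negP => Mu.
have cuz : {for z, continuous u}.
  have OO : @Omega R T `<=` @Omega_closed R T.
    by move=> w /= /andP[w0 wT]; rewrite /Omega_closed/= !ltW.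
  have := continuous_subspaceW OO cu.
  rewrite (continuous_open_subspace _ (@open_Omega T)); apply; exact/mem_set.
have zO : \forall w \near z, Omega T w by apply: open_nbhs_nbhs; split => //; exact: open_Omega.
have zM : \forall w \near z, M < `|u w| by exact: (cvgr_gt _ (cvg_norm cuz) _ Mu).
have /nbhs_ballP[r /= r0 rN] : nbhs z (@Omega R T `&` [set w | M < `|u w|]).
  exact: filterI zO zM.
have BN : ball z.1 r `*` ball z.2 r `<=` N.
  move=> w [w1 w2]; apply: MN => /= H.
  have [Ow Mw] := rN w (conj w1 w2).
  by have := H Ow; rewrite leNgt Mw.
have mB c : measurable (ball c r : set (measurableTypeR R)) by exact: measurable_ball.
have B0 : ((mu \x mu) (ball z.1 r `*` ball z.2 r) = 0)%E.
  apply/eqP; rewrite eq_le measure_ge0 andbT -N0.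
  by apply: le_measure; rewrite ?inE//; exact: measurableX.
have : (mu (ball z.1 r) * mu (ball z.2 r) = 0)%E.
  by rewrite -B0; apply/esym/product_measure1E.
rewrite !lebesgue_measure_ball ?ltW// -EFinM => -[] /eqP.
by rewrite mulf_eq0 orbb gt_eqF// pmulrn_rgt0.
Qed.

Lemma within_continuous_time_slice (T x : R) (u : R * R -> R) :
  {within @Omega_closed R T, continuous u} ->
  {within `[0, T], continuous (fun t => u (x, t))}.
Proof.
move=> /subspace_continuousP cu; apply/subspace_continuousP => t tT.
have O : @Omega_closed R T (x, t) by move: tT; rewrite /= in_itv.
apply: (@cvg_comp _ _ _ (fun t => (x, t)) u _
  (within (@Omega_closed R T) (nbhs (x, t)))); last exact: cu.
move=> P Px.
have H : \forall s \near t, @Omega_closed R T (x, s) -> P (x, s).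
  move: Px => [[A B] [/= Ax Bt] AB].
  by apply: filterS Bt => s Bs; apply: (AB (x, s)); split => //; exact: nbhs_singleton Ax.
change (nbhs t (fun s => `[0, T]%classic s -> P (x, s))).
apply: filterS H => s + sT; apply.
by move: sT; rewrite /= in_itv.
Qed.

(** One inequality is the maximum principle on the strip. For the other, initial values are limits
    of values in the strip as [t] decreases to 0, the line [t = 0] not being part of [Omega T]. *)
Lemma ereal_sup_strip (T kappa K : R) (q : R -> R) (u : R * R -> R) :
  0 < T -> 0 < kappa ->
  continuous q -> (forall x, 0 <= q x) -> inv_diverges_at_ninfty q ->
  {within @Omega_closed R T, continuous u} ->
  (forall z, Omega T z -> `|u z| <= K) ->
  (forall x t, 0 < t < T -> (forall s, 0 <= s <= t -> u (x, s) <= u (x, t)) ->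
    derivable (fun y => u (y, t)) x 1 /\
    kappa * (u (x, t) - u (x, 0)) + q x * derive1 (fun y => u (y, t)) x <= 0) ->
  ereal_sup [set (u z)%:E | z in Omega T] =
  ereal_sup [set (u (x, 0))%:E | x in [set: R]].
Proof.
move=> T0 k0 cq q0 qdiv cu ubd umax; apply/eqP; rewrite eq_le; apply/andP; split.
  set S := ereal_sup [set (u (x, 0))%:E | x in [set: R]].
  have uS x : ((u (x, 0%R))%:E <= S)%E by apply: ereal_sup_ubound; exists x.
  apply: ge_ereal_sup => _ [z Oz <-].
  move: uS; case: S => [M uM| |uM]; last by have := uM 0.
    rewrite lee_fin; apply: (strip_maximum_principle T0 k0 cq q0 qdiv cu ubd _ umax Oz) => x.
    by rewrite -lee_fin.
  by move=> _; rewrite leey.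
set S := ereal_sup [set (u z)%:E | z in Omega T].
have uS z : Omega T z -> ((u z)%:E <= S)%E by move=> Oz; apply: ereal_sup_ubound; exists z.
(* A point of the strip, which rules out a supremum equal to -oo. *)
have OT x : Omega T (x, T / 2) by rewrite /Omega/=; lra.
apply: ge_ereal_sup => _ [x _ <-].
move: uS; case: S => [M uM| |uM]; last by have := uM _ (OT 0).
  rewrite lee_fin leNgt; apply/negP => Mu.
  have /(continuous_within_itvP _ T0)[_ cu0 _] := @within_continuous_time_slice T x u cu.
  have cM : \forall t \near 0^'+, M < u (x, t) by exact: (cvgr_gt _ cu0 _ Mu).
  suff : \forall t \near (0 : R)^'+, False.
    by move=> /filter_ex[].
  near=> t.
  have Mt : M < u (x, t) by near: t.
  have : u (x, t) <= M.
    rewrite -lee_fin; apply: uM; rewrite /Omega/=; apply/andP; split.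
      by near: t; exact: nbhs_right_gt.
    by near: t; exact: nbhs_right_lt.
  by rewrite leNgt Mt.
by move=> _; rewrite leey.
Unshelve. all: by end_near. Qed.

End maximum_principle.

(** * Sign of the source term and extrema of the solution *)

Theorem theorem3p5 (R : realType) (alpha T : R) (q a : R -> R)
    (F u : R * R -> R)
    (alpha_gt0 : 0 < alpha) (alpha_lt1 : alpha < 1) (T_gt0 : 0 < T)
    (q_cont : continuous q) (q_ge0 : forall x, 0 <= q x)
    (q_div : inv_diverges_at_ninfty q)
    (F_cont : {within Omega_closed T, continuous F})
    (a_W11 : W11loc a)
    (u_cont : {within Omega_closed T, continuous u})
    (u_bdd : Linfty (Omega T) u)
    (u_W11t : forall x, W11 `]0, T[ (fun t => u (x, t)))
    (u_W11x : forall t, 0 < t < T -> W11loc (fun x => u (x, t)))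
    (u_eq : forall x t, Omega T (x, t) -> transport_eq_at alpha q F u x t)
    (u_init : forall x, u (x, 0) = a x) :
  ((forall z, Omega T z -> F z <= 0) ->
     ereal_sup [set (u z)%:E | z in Omega T] =
     ereal_sup [set (a x)%:E | x in [set: R]]) /\
  ((forall z, Omega T z -> 0 <= F z) ->
     ereal_inf [set (u z)%:E | z in Omega T] =
     ereal_inf [set (a x)%:E | x in [set: R]]).
Proof.
have [K uK] := continuous_Linfty_bounded u_cont u_bdd.
pose c := (euler_gamma (1 - alpha))^-1.
have c_gt0 : 0 < c by rewrite invr_gt0 euler_gamma_gt0//; lra.
(* Since [t ^ (- alpha) >= T ^ (- alpha)] for [t < T], this constant serves all times at once. *)
pose kappa := c * T `^ (- alpha).
have kappa_gt0 : 0 < kappa by rewrite mulr_gt0 ?powR_gt0.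
have kappa_le t d : 0 < t < T -> 0 <= d -> kappa * d <= c * (t `^ (- alpha) * d).
  move=> /andP[t0 tT] d0; rewrite /kappa -mulrA ler_pM2l// ler_wpM2r//.
  by apply: ler_powR_npos => //; lra.
have -> : a = fun x => u (x, 0) by apply/funext => x; rewrite u_init.
split=> sF.
  apply: (@ereal_sup_strip R T kappa K q) => // x t tT umax.
  have [cap du eqF] := u_eq x t tT; split => //.
  have := caputo_ge_at_max alpha_gt0 alpha_lt1 tT
    (@within_continuous_time_slice R T x u u_cont) (u_W11t x) cap umax.
  have t0 : 0 <= t by case/andP: tT => /ltW.
  have := kappa_le t (u (x, t) - u (x, 0)) tT.
  rewrite subr_ge0 umax ?lexx//; move=> /(_ isT).
  have := sF (x, t) tT; rewrite -eqF /c; lra.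
(* An infimum is by definition the negated supremum of the negated values, so the strip result is
   applied to [\- u], whose maxima in time are minima of [u]. *)
rewrite /ereal_inf; congr (- _)%E; rewrite !image_comp.
apply: (@ereal_sup_strip R T kappa K q (\- u)) => //.
- by move=> z; apply: cvgN; exact: u_cont.
- by move=> z Oz; rewrite /= normrN uK.
move=> x t tT umin'.
have umin s : 0 <= s <= t -> u (x, t) <= u (x, s).
  by move=> /umin' /=; rewrite lerN2.
have [cap du eqF] := u_eq x t tT.
have [dNu dNuE] := is_deriveN (DeriveDef du erefl).
split; first exact: dNu.
rewrite derive1E dNuE -derive1E.
have := caputo_le_at_min alpha_gt0 alpha_lt1 tT
  (@within_continuous_time_slice R T x u u_cont) (u_W11t x) cap umin.
have t0 : 0 <= t by case/andP: tT => /ltW.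
have := kappa_le t (u (x, 0) - u (x, t)) tT.
rewrite subr_ge0 umin ?lexx//; move=> /(_ isT).
have := sF (x, t) tT; rewrite -eqF /c /=; lra.
Qed.
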